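(* Consider the compensating gossip algorithm with deterministic quantizer $q_d$: at each time $t$, when the edge $(i,j)$ is selected, $$x_i(t+1)= x_i(t)-\tfrac12 q_d(x_i(t))+\tfrac12 q_d(x_j(t)),\qquad x_j(t+1)= x_j(t)-\tfrac12 q_d(x_j(t))+\tfrac12 q_d(x_i(t)),$$ and $x_h(t+1)=x_h(t)$ for $h\ne i,j$, starting from a given $x(0)\in\mathbb{R}^N$. Then, almost surely, there exists $T_{\mathrm{con}}\in\mathbb{Z}_{\ge0}$ such that for all $t\ge T_{\mathrm{con}}$, $$|x_i(t)-x_j(t)|\le 1\quad\text{for all } i,j\in\{1,\dots,N\},$$ and hence $$\|x(t)-x_{\mathrm{ave}}(0)\mathbf{1}\|_\infty\le 1 .$$
   Context: Let $\mathcal{G}=(\mathcal{V},\mathcal{E})$ be an undirected connected graph with node set $\mathcal{V}=\{1,\dots,N\}$, whose edges join distinct nodes. At each time $t\in\mathbb{Z}_{\ge0}$ one edge $(i,j)\in\mathcal{E}$ is randomly selected, with probability $W^{(i,j)}>0$, where $\sum_{(i,j)\in\mathcal{E}}W^{(i,j)}=1$; selections at different times are independent. The state is $x(t)=[x_1(t),\dots,x_N(t)]^*\in\mathbb{R}^N$, $\mathbf{1}$ is the all-ones vector, and $x_{\mathrm{ave}}(t)=\frac1N\mathbf{1}^*x(t)$. The deterministic quantizer $q_d:\mathbb{R}\to\mathbb{Z}$ sends $z$ to its nearest integer, as follows: $q_d(z)=n\in\mathbb{Z}$ if and only if $z\in[n-1/2,n+1/2)$ when $z\ge0$, and $z\in(n-1/2,n+1/2]$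 when $z<0$. *)

(* Defs.v *)
From mathcomp Require Import all_boot all_order all_algebra.
From mathcomp Require Import finmap.
From mathcomp Require Import all_classical all_reals all_analysis.
From mathcomp Require Import lra.

Set Implicit Arguments.
Unset Strict Implicit.
Unset Printing Implicit Defensive.

Import Order.TTheory GRing.Theory Num.Theory.
Import numFieldNormedType.Exports.

Local Open Scope classical_set_scope.
Local Open Scope ring_scope.

(* Edges are unordered pairs, i.e. two-element sets of nodes. *)
Definition edges_join_distinct (N : nat) (E : {set {set 'I_N}}) : Prop :=
  forall e, e \in E -> #|e| = 2%N.

Definition adjacent (N : nat) (E : {set {set 'I_N}}) : rel 'I_N :=
  [rel i j | [set i; j]%SET \in E].

Definition connected_graph (N : nat) (E : {set {set 'I_N}}) : Prop :=
  forall i j, connect (adjacent E) i j.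

(* Rounding to the nearest integer, half-integers being rounded away from 0;
   see quantizerP. *)
Definition quantizer (R : realType) (z : R) : int :=
  if 0 <= z then Num.floor (z + 2^-1) else Num.ceil (z - 2^-1).

Lemma quantizerP (R : realType) (z : R) (n : int) :
  quantizer z = n <->
  (if 0 <= z then n%:~R - 2^-1 <= z < n%:~R + 2^-1
   else n%:~R - 2^-1 < z <= n%:~R + 2^-1).
Proof.
rewrite /quantizer; case: ifP => _; split.
- by move=> <-; have := floor_itv (z + 2^-1); rewrite intrD /=; lra.
- by move=> h; apply: floor_def; rewrite intrD; lra.
- by move=> <-; have := ceil_itv (z - 2^-1); rewrite intrB /=; lra.
- by move=> h; apply: ceil_def; rewrite intrB; lra.
Qed.

(* One step from x to y when the edge e is selected. Both orientations of e
   give the same constraints. *)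
Definition compensating_step (R : realType) (q : R -> int) (N : nat)
    (e : {set 'I_N}) (x y : 'cV[R]_N) : Prop :=
  forall i j, e = [set i; j]%SET ->
  [/\ y i 0 = x i 0 - 2^-1 * (q (x i 0))%:~R + 2^-1 * (q (x j 0))%:~R,
      y j 0 = x j 0 - 2^-1 * (q (x j 0))%:~R + 2^-1 * (q (x i 0))%:~R &
      forall h, h != i -> h != j -> y h 0 = x h 0].

Definition average (R : realType) (N : nat) (x : 'cV[R]_N) : R :=
  N%:R^-1 * \sum_i x i 0.

Definition has_law (d : measure_display) (Omega : measurableType d)
    (R : realType) (P : probability Omega R) (T : finType) (A : {set T})
    (W : T -> R) (X : Omega -> T) : Prop :=
  (forall w, X w \in A) /\
  (forall a, a \in A -> measurable (X @^-1` [set a]) /\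
                        P (X @^-1` [set a]) = (W a)%:E).

Definition mutually_independent (d : measure_display)
    (Omega : measurableType d) (R : realType) (P : probability Omega R)
    (T : finType) (X : nat -> Omega -> T) : Prop :=
  forall (J : {fset nat}) (B : nat -> set T),
    P (\bigcap_(t in [set` J]) X t @^-1` B t)
    = (\prod_(t <- J) P (X t @^-1` B t))%E.

(* Main.v *)
Require Import Defs.
From mathcomp Require Import all_boot all_order all_algebra.
From mathcomp Require Import finmap.
From mathcomp Require Import all_classical all_reals all_analysis.
From mathcomp Require Import zify ring lra.
Import Order.TTheory GRing.Theory Num.Theory.
Import numFieldNormedType.Exports.
Local Open Scope classical_set_scope.
Local Open Scope ring_scope.

Set Implicit Arguments.
Unset Strict Implicit.
Unset Printing Implicit Defensive.

(* The states reachable from x(0) lie in x(0) + (1/2)Z^N and are bounded, hence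
   are finitely many; so a single finite word of edges drives all of them to
   recurrent states (those that can be reached back from everything they reach).
   By independence this word almost surely occurs in the edge sequence, and it
   remains to see that recurrent states have spread at most 1.

   Let M be the maximal quantized value of a recurrent state. Quantities that
   can only decrease are constant along its orbit: first the set of nodes with
   q(x_i - 1/2) >= M, then the number of nodes with q(x_i) = M. Hence a node at M
   meeting a lower one exchanges its status with it, so both statuses can be
   transported along the connected graph; this yields x <= M, and symmetrically
   x >= m, unless all quantized values are equal. If M - m >= 2, a node at M can
   be made to meet a node at m, and the exchange is possible only if M = 1,
   m = -1; all values are then in {-1/2, 0, 1/2}. *)

(** * The quantizer *)

Section Quantizer.
Variable R : realType.
Local Notation q := (@quantizer R).

Lemma quantizer_bounds z : (q z)%:~R - 2^-1 <= z <= (q z)%:~R + 2^-1.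
Proof. by have /quantizerP := erefl (q z); case: ifP => _; lra. Qed.

Lemma lt_int_addr1 (m n : int) : m < n -> m%:~R + 1 <= n%:~R :> R.
Proof. by move=> mn; rewrite -(intrD _ m 1) ler_int; lia. Qed.

Lemma quantizer_le x y : x <= y -> q x <= q y.
Proof.
move=> xy; rewrite leNgt; apply/negP => /lt_int_addr1.
have /quantizerP := erefl (q x); have /quantizerP := erefl (q y).
by case: ifP; case: ifP; lra.
Qed.

Lemma quantizer_int (n : int) : q n%:~R = n.
Proof. by apply/quantizerP; case: ifP => _; lra. Qed.

Lemma quantizerN z : q (- z) = - q z.
Proof.
have [->|z0] := eqVneq z 0; first by rewrite oppr0 (quantizer_int 0).
apply/quantizerP; rewrite intrN.
have /quantizerP := erefl (q z); rewrite oppr_ge0.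
by case: (ltgtP z 0) z0 => //; lra.
Qed.

Lemma quantizer_subr1 z : q (z - 1) <= q z - 1.
Proof.
rewrite leNgt; apply/negP => /lt_int_addr1; rewrite intrB.
have /quantizerP := erefl (q z); have /quantizerP := erefl (q (z - 1)).
by case: ifP; case: ifP; lra.
Qed.

(** For [d >= 1], [x <= q x + 1/2] gives [x + d/2 <= q x + d], an integer, which [q] fixes. For
    [d = 0] this is monotonicity. *)
Lemma quantizer_half_shift x y (d : int) :
  0 <= d -> y <= x + d%:~R / 2 -> q y <= q x + d.
Proof.
rewrite le_eqVlt => /predU1P[<-|d0] yx.
  by rewrite addr0 quantizer_le//; move: yx; lra.
rewrite -[leRHS]quantizer_int quantizer_le// intrD.
have := quantizer_bounds x; have := lt_int_addr1 d0.
by move: yx; lra.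
Qed.

(** The equality case of [quantizer_half_shift]: rounding errors of at most 1/2 force [d = 2] and
    make [x] a tie rounded down and [x + 1] a tie rounded up. As ties go away from 0,
    [x < 0 <= x + 1]. *)
Lemma quantizer_half_shift_eq x (d : int) :
  2 <= d -> q (x + d%:~R / 2) = q x + d -> [/\ d = 2, q x = - 1 & x = - 2^-1].
Proof.
move=> d2 qE.
have b1 := quantizer_bounds x; have b2 := quantizer_bounds (x + d%:~R / 2).
rewrite qE intrD in b2.
have dE : d = 2.
  apply/eqP; rewrite eq_le d2 andbT leNgt; apply/negP => /lt_int_addr1.
  by move: b1 b2; lra.
subst d; have xE : x = (q x)%:~R + 2^-1 by move: b1 b2; lra.
have /quantizerP := erefl (q x); case: ifP => x0; first by move: xE x0; lra.
move=> _; have /quantizerP := qE; rewrite intrD.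
case: ifP => x1; last by move: xE x1; lra.
have qx : q x = - 1.
  apply/eqP; rewrite eq_le !leNgt; apply/andP; split;
    apply/negP => /lt_int_addr1; move: xE x0 x1; lra.
by move=> _; split => //; move: xE; rewrite qx; lra.
Qed.
End Quantizer.

Lemma count_lt (T : eqType) (a b : pred T) (s : seq T) x : subpred a b ->
  x \in s -> b x -> ~~ a x -> (count a s < count b s)%N.
Proof.
move=> ab + bx ax; elim: s => //= y s IH; rewrite inE => /predU1P[<-|xs].
  by rewrite bx (negbTE ax) add0n add1n ltnS sub_count.
rewrite -addnS leq_add ?IH//.
by case ay: (a y) => //; rewrite ab.
Qed.

(** * Gossip dynamics and recurrent states *)

Section Gossip.
Variables (R : realType) (N : nat) (E : {set {set 'I_N}}).
Hypothesis hE : edges_join_distinct E.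
Local Notation q := (@quantizer R).
Implicit Types (x y z : 'cV[R]_N) (e : {set 'I_N}) (u v : seq {set 'I_N}).

(** The sum over [e] avoids orienting the edge: node [i] gets
    [x_i - q(x_i) + (q(x_i) + q(x_j)) / 2]. *)
Definition gossip e x : 'cV[R]_N :=
  \col_h if h \in e then x h 0 - (q (x h 0))%:~R
                         + (\sum_(k in e) q (x k 0))%:~R / 2
         else x h 0.

Definition gossips u x := foldl (fun z e => gossip e z) x u.

Lemma edgeE e : e \in E -> exists i j, e = [set i; j]%SET /\ i != j.
Proof. by move=> /hE /eqP/cards2P[i [j [ij ->]]]; exists i, j; split. Qed.

Lemma adjacent_neq i j : Defs.adjacent E i j -> i != j.
Proof. by move=> /hE; rewrite cards2; case: eqP. Qed.

Lemma gossipE i j x : i != j ->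
  gossip [set i; j] x i 0 = x i 0 + (q (x j 0) - q (x i 0))%:~R / 2.
Proof.
move=> ij; rewrite mxE !inE eqxx /= big_setU1 ?inE//= big_set1.
by rewrite !(intrD, intrN); lra.
Qed.

Lemma gossip_notin e x h : h \notin e -> gossip e x h 0 = x h 0.
Proof. by move=> /negbTE he; rewrite mxE he. Qed.

Lemma compensating_stepE e x y : e \in E ->
  compensating_step q e x y -> y = gossip e x.
Proof.
move=> /edgeE[i [j [eE ij]]] /(_ i j eE)[yi yj yh].
apply/colP => h; have [->|hi] := eqVneq h i.
  by rewrite eE gossipE// yi intrB; lra.
have [->|hj] := eqVneq h j.
  by rewrite eE finset.setUC gossipE 1?eq_sym// yj intrB; lra.
by rewrite gossip_notin ?yh// eE !inE negb_or hi.
Qed.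

Lemma gossipN e x : gossip e (- x) = - gossip e x.
Proof.
apply/colP => h; rewrite !mxE; case: ifP => // _.
rewrite (eq_bigr (fun k => - q (x k 0))); last first.
  by move=> k _; rewrite !mxE quantizerN.
by rewrite sumrN quantizerN !intrN; lra.
Qed.

Lemma quantizer_mxN x i : q ((- x) i 0) = - q (x i 0).
Proof. by rewrite mxE quantizerN. Qed.

Lemma gossip_sum e x : e \in E -> \sum_i gossip e x i 0 = \sum_i x i 0.
Proof.
move=> /edgeE[i [j [-> ij]]].
rewrite (bigD1 i)//= (bigD1 j) 1?eq_sym//=
  [RHS](bigD1 i)//= [in RHS](bigD1 j) 1?eq_sym//=.
rewrite gossipE// finset.setUC gossipE 1?eq_sym// !addrA; congr (_ + _).
  by rewrite !intrB; lra.
by apply: eq_bigr => k /andP[ki kj]; rewrite gossip_notin// !inE negb_or kj.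
Qed.

Lemma gossipsN u x : gossips u (- x) = - gossips u x.
Proof. by elim: u x => //= e u IH x; rewrite gossipN IH. Qed.

Lemma gossips_cat u v x : gossips (u ++ v) x = gossips v (gossips u x).
Proof. exact: foldl_cat. Qed.

Definition reach x y := exists2 u, all (mem E) u & y = gossips u x.

Lemma reach_refl x : reach x x.
Proof. by exists [::]. Qed.

Lemma reach_trans y x z : reach x y -> reach y z -> reach x z.
Proof.
move=> [u uE ->] [v vE ->]; exists (u ++ v); last by rewrite gossips_cat.
by rewrite all_cat uE.
Qed.

Lemma reach_gossip e x : e \in E -> reach x (gossip e x).
Proof. by move=> eE; exists [:: e]; rewrite //= andbT. Qed.

Lemma reach_ind (Q : 'cV[R]_N -> Prop) x :
  Q x -> (forall e z, e \in E -> reach x z -> Q z -> Q (gossip e z)) ->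
  forall y, reach x y -> Q y.
Proof.
move=> Qx QS y [u + ->] {y}; elim/last_ind: u => [//|u e IH].
rewrite all_rcons => /andP[eE uE].
rewrite /gossips foldl_rcons; apply: QS => //; last exact: IH.
by exists u.
Qed.

Lemma reachN x y : reach x y -> reach (- x) (- y).
Proof. by move=> [u uE ->]; exists u; rewrite ?gossipsN. Qed.

Definition recurrent x := forall y, reach x y -> reach y x.

Lemma recurrent_reach x y : recurrent x -> reach x y -> recurrent y.
Proof.
by move=> rx xy z yz; apply: (reach_trans _ xy); apply/rx/(reach_trans xy).
Qed.

Lemma recurrentN x : recurrent x -> recurrent (- x).
Proof.
move=> rx y /reachN; rewrite opprK => /rx /reachN; by rewrite opprK.
Qed.

(** The path back from [gossip e z] to [z] cannot increase [f], so the step cannot have decreased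
    it. *)
Lemma recurrent_const (f : 'cV[R]_N -> nat) x : recurrent x ->
  (forall e z, e \in E -> reach x z -> (f (gossip e z) <= f z)%N) ->
  forall e z, e \in E -> reach x z -> f (gossip e z) = f z.
Proof.
move=> rx fS e z eE xz; apply/eqP; rewrite eqn_leq fS//=.
have rz := recurrent_reach rx xz.
have : reach (gossip e z) z by apply/rz/reach_gossip.
move: z {rz} xz => z xz.
have xg : reach x (gossip e z) by apply/(reach_trans xz)/reach_gossip.
move: (gossip e z) xg => y xy yz.
elim/reach_ind: z / yz {xz} => // e' z' e'E yz' le.
by apply: leq_trans le; apply: fS => //; apply: reach_trans yz'.
Qed.

Definition quantized_le (M : int) x := forall i, q (x i 0) <= M.

Lemma gossip_quantizer_le i j M x : i != j -> q (x i 0) <= M -> q (x j 0) <= M ->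
  q (gossip [set i; j] x i 0) <= M.
Proof.
move=> ij xi xj; rewrite gossipE// -[leRHS](subrKC (q (x i 0))).
apply: quantizer_half_shift; first by rewrite subr_ge0.
by rewrite lerD2l ler_pM2r ?invr_gt0// ler_int; lia.
Qed.

Lemma gossip_quantized_le e M x : e \in E ->
  quantized_le M x -> quantized_le M (gossip e x).
Proof.
move=> /edgeE[i [j [-> ij]]] xM h.
have [->|hi] := eqVneq h i; first exact: gossip_quantizer_le.
have [->|hj] := eqVneq h j; last by rewrite gossip_notin// !inE negb_or hi.
by rewrite finset.setUC gossip_quantizer_le// eq_sym.
Qed.

Lemma reach_quantized_le M x y : quantized_le M x -> reach x y -> quantized_le M y.
Proof. by move=> xM; elim/reach_ind => // e z eE _; exact: gossip_quantized_le. Qed.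

(* When i meets a node of smaller quantized value, x_i drops by at least 1/2.
   A node of top M outside high M thus leaves top M at such a meeting. *)
Definition high (M : int) x := [set i | M <= q (x i 0 - 2^-1)]%SET.
Definition top (M : int) x := [set i | M <= q (x i 0)]%SET.

(** A node at level [M] can only move down. For a node [k] below [M], the increment minus 1/2 is at
    most [(M - 1 - q(x_k)) / 2], so [quantizer_half_shift] keeps it out of [high M]. *)
Lemma gossip_high_stable e M x : e \in E -> quantized_le M x ->
  (high M (gossip e x) \subset high M x)%SET.
Proof.
move=> /edgeE[i [j [-> ij]]] xM.
have H k l : k != l -> M <= q (gossip [set k; l] x k 0 - 2^-1) ->
    M <= q (x k 0 - 2^-1).
  move=> kl; rewrite gossipE//; have xk := xM k; have xl := xM l.
  have [xkM|xkM] := leP M (q (x k 0)).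
    move=> /le_trans; apply; apply: quantizer_le.
    have : (q (x l 0) - q (x k 0))%:~R <= 0 :> R by rewrite lerz0; lia.
    lra.
  move=> Mq; exfalso.
  suff : q (x k 0 + (q (x l 0) - q (x k 0))%:~R / 2 - 2^-1)
    <= q (x k 0) + (M - 1 - q (x k 0)) by lia.
  apply: quantizer_half_shift; first lia.
  have : (q (x l 0) - q (x k 0))%:~R <= (M - 1 - q (x k 0))%:~R + 1 :> R.
    by rewrite -(intrD _ _ 1) ler_int; lia.
  lra.
apply/fintype.subsetP => h; rewrite !inE; have [->|hi] := eqVneq h i; first exact: H.
have [->|hj] := eqVneq h j; first by rewrite finset.setUC; apply: H; rewrite eq_sym.
by rewrite gossip_notin// !inE negb_or hi.
Qed.

(** The drop of at least 1/2 and the 1/2 in [high] add up to a full unit, which lowers the quantized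
    value by at least 1. *)
Lemma gossip_high_leave i j M x : i != j -> quantized_le M x ->
  i \in top M x -> j \notin top M x -> i \notin high M (gossip [set i; j] x).
Proof.
move=> ij xM; have xi := xM i; rewrite !inE gossipE// -!ltNge => Mi xj.
suff : q (x i 0 + (q (x j 0) - q (x i 0))%:~R / 2 - 2^-1) <= q (x i 0) - 1 by lia.
apply: (le_trans _ (quantizer_subr1 _)); apply: quantizer_le.
by have := lt_int_addr1 R (lt_le_trans xj Mi); rewrite intrB; lra.
Qed.

Lemma gossip_top_leave i j M x : i != j -> i \notin high M x ->
  i \in top M x -> j \notin top M x -> i \notin top M (gossip [set i; j] x).
Proof.
move=> ij; rewrite !inE gossipE// -!ltNge => xh Mi xj; apply: le_lt_trans xh.
apply: quantizer_le.
by have := lt_int_addr1 R (lt_le_trans xj Mi); rewrite intrB; lra.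
Qed.

(** * Quantities conserved along the orbit of a recurrent state *)

Section Recurrent.
Variables (M : int) (y : 'cV[R]_N).
Hypotheses (ry : recurrent y) (yM : quantized_le M y).

Let reachM z : reach y z -> quantized_le M z.
Proof. exact: reach_quantized_le. Qed.

Lemma recurrent_high e z : e \in E -> reach y z -> high M (gossip e z) = high M z.
Proof.
move=> eE yz; apply/eqP; rewrite eqEcard (gossip_high_stable eE (reachM yz))//=.
suff -> : #|high M (gossip e z)| = #|high M z| by [].
apply: (recurrent_const (f := fun x => #|high M x|) ry _ eE yz).
by move=> e' z' e'E yz'; rewrite subset_leq_card// (gossip_high_stable e'E (reachM yz')).
Qed.

(** Were [i] in [high M z], the meeting would remove it, against [recurrent_high]. *)
Lemma recurrent_top_leave i j z : reach y z -> Defs.adjacent E i j ->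
  i \in top M z -> j \notin top M z ->
  i \notin high M z /\ i \notin top M (gossip [set i; j] z).
Proof.
move=> yz ij zi zj; have nij := adjacent_neq ij.
have zh : i \notin high M z.
  by rewrite -(recurrent_high ij yz) (gossip_high_leave nij (reachM yz)).
by split=> //; exact: gossip_top_leave.
Qed.

Lemma gossip_top_sub i j z : reach y z -> Defs.adjacent E i j ->
  i \in top M z -> j \notin top M z ->
  (top M (gossip [set i; j] z) \subset j |: top M z :\ i)%SET.
Proof.
move=> yz ij zi zj; apply/fintype.subsetP => h.
have [_ hi] := recurrent_top_leave yz ij zi zj.
rewrite in_setU1 in_setD1; have [->|hni] := eqVneq h i; first by rewrite (negbTE hi).
have [//|hnj] := eqVneq h j.
by rewrite inE gossip_notin ?inE ?negb_or ?hni.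
Qed.

(** When exactly one end is in [top M], that end leaves and only the other can enter. Two top nodes
    have equal quantized values and do not move; two lower ones stay at most [M - 1]. *)
Lemma recurrent_top_card e z : e \in E -> reach y z ->
  #|top M (gossip e z)| = #|top M z|.
Proof.
move: e z; apply: (recurrent_const (f := fun x => #|top M x|) ry) => e z eE yz.
have swap i j : Defs.adjacent E i j -> i \in top M z -> j \notin top M z ->
    (#|top M (gossip [set i; j] z)| <= #|top M z|)%N.
  move=> ij zi zj.
  apply: (leq_trans (subset_leq_card (gossip_top_sub yz ij zi zj))).
  by rewrite cardsU1 !inE (cardsD1 i (top M z)) zi leq_add2r; case: (_ && _).
have [i [j [eij ij]]] := edgeE eE; rewrite {}eij in eE *.
have [zi|zi] := boolP (i \in top M z); have [zj|zj] := boolP (j \in top M z).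
- rewrite (_ : gossip _ _ = z)//; apply/colP => h.
  have qij : q (z i 0) = q (z j 0).
    have := reachM yz i; have := reachM yz j; move: zi zj; rewrite !inE; lia.
  have [->|hi] := eqVneq h i; first by rewrite gossipE// qij subrr mul0r addr0.
  have [->|hj] := eqVneq h j; last by rewrite gossip_notin// !inE negb_or hi.
  by rewrite finset.setUC gossipE 1?eq_sym// qij subrr mul0r addr0.
- exact: swap.
- by rewrite finset.setUC; apply: swap => //; rewrite /Defs.adjacent/= finset.setUC.
- apply/subset_leq_card/fintype.subsetP => h.
  have [->|hi] := eqVneq h i.
    move: zi zj; rewrite !inE -!ltNge => zi zj.
    have : q (gossip [set i; j] z i 0) <= M - 1 by apply: gossip_quantizer_le => //; lia.
    lia.
  have [->|hj] := eqVneq h j; last by rewrite !inE gossip_notin// !inE negb_or hi.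
  move: zi zj; rewrite finset.setUC !inE -!ltNge => zi zj.
  have : q (gossip [set j; i] z j 0) <= M - 1.
    by apply: gossip_quantizer_le; rewrite 1?eq_sym//; lia.
  lia.
Qed.

(** Since [i] leaves and only [j] can enter, constancy of the cardinality forces [j] in. *)
Lemma recurrent_swap i j z : reach y z -> Defs.adjacent E i j ->
  i \in top M z -> j \notin top M z ->
  i \notin top M (gossip [set i; j] z) /\ j \in top M (gossip [set i; j] z).
Proof.
move=> yz ij zi zj; have [_ hi] := recurrent_top_leave yz ij zi zj; split=> //.
apply: contraT => hj.
have : (top M (gossip [set i; j] z) \subset top M z :\ i)%SET.
  apply/fintype.subsetP => h hz.
  have := fintype.subsetP (gossip_top_sub yz ij zi zj) _ hz.
  by rewrite in_setU1; case: eqVneq => // hjE; move: hz hj; rewrite hjE => ->.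
move=> /subset_leq_card; rewrite recurrent_top_card//.
by rewrite (cardsD1 i (top M z)) zi ltnn.
Qed.

Lemma recurrent_top_neq0 z : reach y z -> top M y != finset.set0 -> top M z != finset.set0.
Proof.
move=> yz; rewrite -!card_gt0; elim/reach_ind: z / yz => // e z eE yz IH /IH.
by rewrite recurrent_top_card.
Qed.

End Recurrent.

Hypothesis hconn : connected_graph E.

(** * Transport of statuses along the connected graph *)

Section Transport.
Variables (M : int) (y : 'cV[R]_N).
Hypotheses (ry : recurrent y) (yM : quantized_le M y).

(** Walk back along a path from [i] to [j], with last edge [w], [v]. If [w] has the status of [i]
    and differs from [i], gossip on this edge swaps the statuses of [w] and [v] without touching
    [i]; the path then ends at [w]. *)
Lemma bring_top i j z : reach y z -> (j \in top M z) != (i \in top M z) ->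
  exists z' k, [/\ reach y z', z' i 0 = z i 0, Defs.adjacent E i k &
                   (k \in top M z') != (i \in top M z')].
Proof.
have [p + ->] := connectP (hconn i j) => {j}.
elim/last_ind: p z => [|p v IH] z /=; first by rewrite eqxx.
rewrite rcons_path last_rcons => /andP[pp]; set w := last i p => wv yz vi.
have [wi|wi] := eqVneq (w \in top M z) (i \in top M z); last exact: (IH z).
have [iw|iw] := eqVneq w i; first by exists z, v; split=> //; rewrite -iw.
have iv : i != v by apply: contraNneq vi => ->.
have zi : gossip [set w; v] z i 0 = z i 0.
  by rewrite gossip_notin// !inE negb_or eq_sym iw.
have yz' : reach y (gossip [set w; v] z) by apply/(reach_trans yz)/reach_gossip.
have iM : (i \in top M (gossip [set w; v] z)) = (i \in top M z) by rewrite !inE zi.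
have wM : (w \in top M (gossip [set w; v] z)) != (i \in top M (gossip [set w; v] z)).
  rewrite iM -wi; move: vi; rewrite -wi.
  have [wz|wz] := boolP (w \in top M z); rewrite ?eqb_id ?eqbF_neg ?negbK => vz.
    by case: (recurrent_swap ry yM yz wv wz vz).
  rewrite finset.setUC.
  by case: (recurrent_swap ry yM yz _ vz wz) => //; rewrite /Defs.adjacent/= finset.setUC.
have [z' [k [yz'' z'i ik kM]]] := IH _ pp yz' wM.
by exists z', k; split=> //; rewrite z'i.
Qed.

(** Otherwise [i] is in [top M], and a neighbour outside [top] can be brought to it with its value,
    hence its highness, unchanged, against [recurrent_top_leave]. *)
Lemma recurrent_not_high i j : j \notin top M y -> i \notin high M y.
Proof.
move=> jM; apply/negP => ih.
have iM : i \in top M y.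
  by move: ih; rewrite !inE => /le_trans; apply; apply: quantizer_le; lra.
have [||z [k [yz zi ik kM]]] := @bring_top i j y; first exact: reach_refl.
  by rewrite iM (negbTE jM).
have iz : i \in top M z by move: iM; rewrite !inE zi.
have [|] := recurrent_top_leave ry yM yz ik iz; first by move: kM; rewrite iz; case: (_ \in _).
by move: ih; rewrite !inE zi => ->.
Qed.

Lemma recurrent_le i j : j \notin top M y -> y i 0 <= M%:~R.
Proof.
move=> /(recurrent_not_high i); rewrite inE -ltNge => /(lt_int_addr1 R).
by have := quantizer_bounds (y i 0 - 2^-1); lra.
Qed.

(** The top status travels along a path towards [j] by swaps, until the next node has level [m]. The
    end of the path keeps its value, being neither of the swapped nodes. *)
Lemma recurrent_meeting m i j z : m < M -> reach y z ->
  i \in top M z -> q (z j 0) = m ->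
  exists z' i' j', [/\ reach y z', Defs.adjacent E i' j',
                       i' \in top M z' & q (z' j' 0) = m].
Proof.
move=> mM; have [p + ->] := connectP (hconn i j) => {j}.
elim: p i z => [|v p IH] i z /=.
  by move=> _ _; rewrite inE => + zi; rewrite zi; lia.
move=> /andP[iv pp] yz zi zl.
have [vM|vM] := boolP (v \in top M z); first exact: (IH v z).
have [vm|vm] := eqVneq (q (z v 0)) m; first by exists z, i, v.
have [iM' vM'] := recurrent_swap ry yM yz iv zi vM.
apply: (IH v _ pp _ vM'); first by apply/(reach_trans yz)/reach_gossip.
rewrite gossip_notin// !inE; apply/norP; split; apply/negP => /eqP lE.
  by move: zi; rewrite inE -lE zl; lia.
by move: vm; rewrite -lE zl eqxx.
Qed.

(** The swap must lift [j] to level [M] in one step, a half shift by [M - q(z_j) >= 2] that attains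
    the bound. *)
Lemma recurrent_meet i j z : reach y z -> Defs.adjacent E i j ->
  i \in top M z -> q (z j 0) <= M - 2 ->
  [/\ M = 1, q (z j 0) = - 1 & z j 0 = - 2^-1].
Proof.
move=> yz ij zi zj; have zjM : j \notin top M z by rewrite inE; lia.
have zM := reach_quantized_le yM yz; have qi : q (z i 0) = M.
  by have := zM i; move: zi; rewrite inE; lia.
have ji : j != i by rewrite eq_sym adjacent_neq.
have [_] := recurrent_swap ry yM yz ij zi zjM.
rewrite finset.setUC inE gossipE// qi => Mj.
have [||dE qj zjE] := @quantizer_half_shift_eq R (z j 0) (M - q (z j 0)); first lia.
  apply/eqP; rewrite eq_le (_ : q (z j 0) + _ = M); last lia.
  by rewrite Mj andbT -{1}qi -gossipE// gossip_quantizer_le// zM.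
by split=> //; lia.
Qed.

End Transport.

(* Since q_d rounds 1/2 to 1 and -1/2 to -1, three quantized values can persist
   forever: the values -1/2, 0, 1/2 are merely exchanged by the gossip steps. *)
Definition ternary y := [/\ recurrent y, quantized_le 1 y, quantized_le 1 (- y),
  top 1 y != finset.set0 & top 1 (- y) != finset.set0].

Lemma ternaryN y : ternary y -> ternary (- y).
Proof. by case=> ry y1 y1' t t'; split; rewrite ?opprK//; exact: recurrentN. Qed.

Lemma ternary_reach y z : ternary y -> reach y z -> ternary z.
Proof.
move=> [ry y1 y1' t t'] yz; split.
- exact: recurrent_reach yz.
- exact: reach_quantized_le yz.
- by apply: (reach_quantized_le y1'); exact: reachN.
- exact: recurrent_top_neq0 yz _.
- by apply: (recurrent_top_neq0 (recurrentN ry) _ (reachN yz)).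
Qed.

(** A top neighbour brought to [j] must swap with it, so [q(y_j + 1/2) >= 1] and [y_j >= 0].
    Negation gives the other inequality. *)
Lemma ternary_zero y j : ternary y -> q (y j 0) = 0 -> y j 0 = 0.
Proof.
have H z : ternary z -> q (z j 0) = 0 -> 0 <= z j 0.
  move=> [rz z1 _ /finset.set0Pn[i it] _] qj.
  have jt : j \notin top 1 z by rewrite inE qj.
  have [||z' [k [zz' z'j jk kt]]] := @bring_top 1 z rz z1 j i z; first exact: reach_refl.
    by rewrite it (negbTE jt).
  have jt' : j \notin top 1 z' by rewrite inE z'j qj.
  have kt' : k \in top 1 z' by move: kt; rewrite (negbTE jt'); case: (_ \in _).
  have kj : Defs.adjacent E k j by rewrite /Defs.adjacent/= finset.setUC.
  have qk : q (z' k 0) = 1.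
    by have := reach_quantized_le z1 zz' k; move: kt'; rewrite inE; lia.
  have [_] := recurrent_swap rz z1 zz' kj kt' jt'.
  rewrite finset.setUC inE gossipE ?adjacent_neq// z'j qj qk subr0 => q1.
  have /(lt_int_addr1 R) : 0 < q (z j 0 + 1%:~R / 2) by lia.
  by have := quantizer_bounds (z j 0 + 1%:~R / 2); lra.
move=> ty qj; apply/le_anti; rewrite H// andbT -oppr_ge0.
by have := H _ (ternaryN ty); rewrite quantizer_mxN qj oppr0 mxE; apply.
Qed.

Lemma ternary_top y i : ternary y -> q (y i 0) = 1 -> y i 0 = 2^-1.
Proof.
move=> ty qi; have [ry y1 y1' _ /finset.set0Pn[j]] := ty.
rewrite inE quantizer_mxN => qj.
have it : i \in top 1 y by rewrite inE qi.
have jt : j \notin top 1 y by rewrite inE; lia.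
have [||z [k [yz zi ik kt]]] := @bring_top 1 y ry y1 i j y; first exact: reach_refl.
  by rewrite it (negbTE jt).
have it' : i \in top 1 z by rewrite inE zi qi.
have kt' : k \notin top 1 z by move: kt; rewrite it'; case: (_ \in _).
have [rz z1 z1' _ _] := ternary_reach ty yz.
have ki : Defs.adjacent E k i by rewrite /Defs.adjacent/= finset.setUC.
have := z1' k; rewrite quantizer_mxN => qk.
(* The non-top neighbour [k] has level 0 or -1. At -1, [recurrent_meet] for [- z] fixes the value of
   [i]; at 0, the meeting brings [i] to level 0, where [ternary_zero] applies. *)
have [qk0|qkN] := eqVneq (q (z k 0)) 0; last first.
  have [||_ _] := @recurrent_meet 1 (- z) (recurrentN rz) z1' k i (- z) (reach_refl _) ki.
  - by rewrite inE quantizer_mxN; move: kt'; rewrite inE; lia.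
  - by rewrite quantizer_mxN zi qi.
  - by rewrite mxE zi; lra.
have [_] := recurrent_top_leave ry y1 yz ik it' kt'.
rewrite inE -ltNge => gi.
have tg := ternary_reach ty (reach_trans yz (reach_gossip z ik)).
have gE : gossip [set i; k] z i 0 = y i 0 - 2^-1.
  by rewrite gossipE ?adjacent_neq// zi qi qk0 sub0r intrN; lra.
have : gossip [set i; k] z i 0 = 0.
  apply: (ternary_zero tg); apply/eqP; rewrite eq_le; apply/andP; split.
    by rewrite -ltzD1 add0r.
  rewrite -[leLHS](quantizer_int R) quantizer_le// gE.
  by have := quantizer_bounds (y i 0); rewrite qi; lra.
by rewrite gE; lra.
Qed.

Lemma ternary_values y i : ternary y -> [\/ y i 0 = - 2^-1, y i 0 = 0 | y i 0 = 2^-1].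
Proof.
move=> ty; have [_ /(_ i) y1 /(_ i) + _ _] := ty; rewrite quantizer_mxN => y1'.
have [q1|q1] := eqVneq (q (y i 0)) 1; first by apply: Or33; exact: ternary_top.
have [q0|q0] := eqVneq (q (y i 0)) 0; first by apply: Or32; exact: ternary_zero.
apply: Or31; have := ternary_top (i := i) (ternaryN ty).
by rewrite quantizer_mxN mxE => <-; rewrite ?opprK//; lia.
Qed.

(** * The spread of recurrent states *)

Lemma top_extremum y (i : 'I_N) : exists M, quantized_le M y /\ top M y != finset.set0.
Proof.
case: (@Order.TotalTheory.arg_maxP _ _ _ i xpredT (fun k => q (y k 0)) isT) => k _ kM.
exists (q (y k 0)); split; first by move=> j; exact: kM.
by apply/finset.set0Pn; exists k; rewrite inE.
Qed.

Lemma recurrent_spread y i j : recurrent y -> `|y i 0 - y j 0| <= 1.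
Proof.
move=> ry; have ryN := recurrentN ry.
have [M [yM tM]] := top_extremum y i; have [m [ym tm]] := top_extremum (- y) i.
have [a] := finset.set0Pn _ tM; have [b] := finset.set0Pn _ tm.
rewrite !inE quantizer_mxN => qb qa.
have qy k : - m <= q (y k 0) <= M.
  by have := ym k; have := yM k; rewrite quantizer_mxN; lia.
have := qy a; have := qy b; have := qy i; have := qy j => qj qi qb' qa'.
(* The minimal level is [- m], as [m] is the maximal one for [- y]. With a single level, all values
   lie in one rounding interval of length 1. *)
have [Mm|Mm] := eqVneq M (- m).
  have [qiM qjM] : q (y i 0) = M /\ q (y j 0) = M by lia.
  have := quantizer_bounds (y i 0); have := quantizer_bounds (y j 0).
  by rewrite qiM qjM ler_norml; lra.
have yle k : y k 0 <= M%:~R.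
  by apply: (@recurrent_le M y ry yM k b); rewrite inE; lia.
have yge k : (- m)%:~R <= y k 0.
  have := @recurrent_le m (- y) ryN ym k a; rewrite inE quantizer_mxN mxE intrN.
  by move=> /(_ _); rewrite lerNl; apply; lia.
have [Mm1|Mm1] := leP M (- m + 1).
  have : M%:~R <= (- m)%:~R + 1 :> R by rewrite -(intrD _ _ 1) ler_int.
  by have := yle i; have := yle j; have := yge i; have := yge j; rewrite ler_norml; lra.
(* Levels at least 2 apart: a top node is made to meet a bottom one, which leaves only the ternary
   case. *)
have [||||z [i' [j' [yz ij zi zj]]]] := @recurrent_meeting M y ry yM (- m) a b y.
- lia.
- exact: reach_refl.
- by rewrite inE.
- lia.
have [|M1 m1 _] := recurrent_meet ry yM yz ij zi; first lia.
have ty : ternary y by split; rewrite -?M1// (_ : M = m)//; lia.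
rewrite ler_norml.
by have [->|->|->] := ternary_values i ty; have [->|->|->] := ternary_values j ty; lra.
Qed.

(** * Finiteness of the orbit and a common word leading to recurrence *)

Lemma reach_finite x : exists S : seq 'cV[R]_N, forall z, reach x z -> z \in S.
Proof.
(* Levels stay within [B], so an entry moves by at most [2 * B + 1], that is [K] half units. *)
pose B := \max_i `|q (x i 0%R)|%N; pose K := (4 * B + 2)%N.
have xB i : (`|q (x i 0%R)| <= B)%N by exact: (leq_bigmax i).
have x1 : quantized_le B%:Z x by move=> i; have := xB i; lia.
have x2 : quantized_le B%:Z (- x).
  by move=> i; rewrite quantizer_mxN; have := xB i; lia.
have H z : reach x z -> exists k : 'I_N -> int, forall i, z i 0 = x i 0 + (k i)%:~R / 2.
  elim/reach_ind => [|e y eE xy [k ky]].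
    by exists (fun=> 0) => i; rewrite mul0r addr0.
  exists (fun i => if i \in e
    then k i - 2 * q (y i 0) + \sum_(j in e) q (y j 0) else k i) => i.
  rewrite mxE; case: ifP => // _.
  by rewrite ky !(intrD, intrN, intrM); lra.
exists [seq \col_i (x i 0 + ((f i : nat)%:R - K%:R) / 2) |
         f : {ffun 'I_N -> 'I_(2 * K).+1}] => z xz.
have [k zk] := H z xz.
have kK i : (`|k i| <= K)%N.
  have z1 := reach_quantized_le x1 xz i.
  have := reach_quantized_le x2 (reachN xz) i; rewrite quantizer_mxN => z2.
  have bx := quantizer_bounds (x i 0); have bz := quantizer_bounds (z i 0).
  have k2 : (k i)%:~R = 2 * (z i 0 - x i 0) by rewrite zk; lra.
  have lo : (- K%:Z)%:~R <= (k i)%:~R :> R.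
    have : (- B%:Z)%:~R <= (q (z i 0))%:~R :> R by rewrite ler_int; lia.
    have : (q (x i 0))%:~R <= B%:Z%:~R :> R by rewrite ler_int; have := xB i; lia.
    rewrite k2 /K !(intrD, intrN, intrM, PoszD, PoszM); lra.
  have hi : (k i)%:~R <= K%:Z%:~R :> R.
    have : (q (z i 0))%:~R <= B%:Z%:~R :> R by rewrite ler_int; lia.
    have : (- B%:Z)%:~R <= (q (x i 0))%:~R :> R by rewrite ler_int; have := xB i; lia.
    rewrite k2 /K !(intrD, intrN, intrM, PoszD, PoszM); lra.
  by move: lo hi; rewrite !ler_int; lia.
apply/mapP; exists [ffun i => inord `|(k i + K%:Z)%R|%N]; first by rewrite mem_enum.
apply/colP => i; rewrite mxE ffunE inordK; last by have := kK i; lia.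
have -> : (`|(k i + K%:Z)%R|%N)%:R = (k i + K%:Z)%:~R :> R.
  by rewrite pmulrn; congr (_%:~R); have := kK i; lia.
by rewrite zk intrD /=; lra.
Qed.

(** If [x] is not recurrent, some reachable [y] cannot return to [x], so strictly fewer states are
    reachable from [y]; induct on their number. *)
Lemma reach_recurrent x : exists2 y, reach x y & recurrent y.
Proof.
have [S] := reach_finite x.
have [n] := ubnP (count (fun z => `[< reach x z >]) S).
elim: n x => // n IH x; rewrite ltnS => xn xS.
have [rx|] := pselect (recurrent x); first by exists x => //; exact: reach_refl.
move=> /existsNP[y /not_implyP[xy yx]].
have [|z yz|z yz rz] := IH y; last by exists z => //; exact: reach_trans yz.
- apply: leq_trans xn; apply: (@count_lt _ _ _ _ x).
  + by move=> z /asboolP yz; apply/asboolP/(reach_trans xy).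
  + exact/xS/reach_refl.
  + exact/asboolP/reach_refl.
  + exact/asboolP.
- exact/xS/(reach_trans xy).
Qed.

(** The word is extended for one state at a time; states already driven to recurrence remain
    recurrent under the extension. *)
Lemma recurrent_word x : exists2 u, all (mem E) u &
  forall y, reach x y -> recurrent (gossips u y).
Proof.
have [S xS] := reach_finite x.
suff [u uE uS] : exists2 u, all (mem E) u &
    forall y, y \in S -> reach x y -> recurrent (gossips u y).
  by exists u => // y xy; apply: uS => //; exact: xS.
elim: S {xS} => [|y S [u uE uS]]; first by exists [::].
have [_ [v vE ->] ry] := reach_recurrent (gossips u y).
exists (u ++ v); first by rewrite all_cat uE.
move=> z; rewrite inE gossips_cat => /predU1P[->//|zS xz].
by apply: recurrent_reach (uS _ zS xz) _; exists v.
Qed.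

End Gossip.

(** * Almost sure occurrence of finite words *)

Lemma uniq_unzip1_eq (S T : eqType) (c : seq (S * T)) t a b :
  uniq (unzip1 c) -> (t, a) \in c -> (t, b) \in c -> a = b.
Proof.
elim: c => //= -[s d] c IH /andP[sc uc]; rewrite !inE.
have notin e : (s, e) \in c -> False.
  by move=> h; move: sc; rewrite (map_f fst h).
move=> /predU1P[[-> ->]|ac] /predU1P[h|bc]; first by case: h.
- by case: (notin b).
- by case: h ac => -> _ /notin.
- exact: IH.
Qed.

Section Words.
Variables (R : realType) (d : measure_display) (Omega : measurableType d).
Variables (P : probability Omega R) (T : finType) (A : {set T}) (W : T -> R).
Variable X : nat -> Omega -> T.
Hypothesis hlaw : forall t, has_law P A W (X t).
Hypothesis hindep : mutually_independent P X.
Implicit Types (c : seq (nat * T)) (u : seq T).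

Definition cylinder c := [set w | forall p, p \in c -> X p.1 w = p.2].

Definition values_in c := all (fun p => p.2 \in A) c.

Lemma cylinderE c :
  cylinder c = \bigcap_(p in [set` c]) X p.1 @^-1` [set p.2].
Proof. by apply/seteqP; split. Qed.

Lemma measurable_cylinder c : values_in c -> measurable (cylinder c).
Proof.
move=> /allP cA; rewrite cylinderE; apply: fin_bigcap_measurable => //.
by move=> p /cA pA; have [_ /(_ _ pA)[]] := hlaw p.1.
Qed.

Lemma probability_cylinder c : values_in c -> uniq (unzip1 c) ->
  P (cylinder c) = (\prod_(p <- c) W p.2)%:E.
Proof.
move=> /allP cA cu.
pose J := [fset t in unzip1 c]%fset.
(* Times in [c] are distinct, so [B t] is a singleton for each [t] in [J]. *)
pose B t := [set e | (t, e) \in c].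
have -> : cylinder c = \bigcap_(t in [set` J]) X t @^-1` B t.
  apply/seteqP; split => [w cw t|w cw [t e] pc] /=.
    rewrite !inE /= => /mapP[[s e] pc /= ->].
    by rewrite /B/= (cw _ pc).
  have : (t, X t w) \in c by apply: cw; rewrite /= !inE (map_f fst pc).
  by move=> /(uniq_unzip1_eq cu); apply.
rewrite hindep (perm_big (unzip1 c)); last first.
  by apply: uniq_perm => [||t]; rewrite ?fset_uniq// /J !inE.
rewrite big_map big_seq [in RHS]big_seq -prodEFin; apply: eq_bigr => -[t e] pc.
have [_ /(_ _ (cA _ pc))[_ <-]] := hlaw t; congr (P _).
apply/seteqP; split => w; rewrite /B /=; first by move=> /(uniq_unzip1_eq cu); apply.
by move=> ->.
Qed.

Variable u : seq T.
Hypothesis uA : all (mem A) u.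

(** The blocks occupy disjoint consecutive time windows, which is what makes their occurrences
    independent. *)
Definition block (k : nat) := zip (iota (k * size u) (size u)) u.

Fixpoint avoid n :=
  if n is m.+1 then avoid m `\` cylinder (block m) else setT.

Lemma block_values k : values_in (block k).
Proof.
apply/allP => -[t e] /(map_f snd); rewrite -[map _ _]/(unzip2 _).
by rewrite unzip2_zip ?size_iota// => /(allP uA).
Qed.

Lemma measurable_avoid n : measurable (avoid n).
Proof.
elim: n => [|n IH] /=; first exact: measurableT.
exact/measurableD/measurable_cylinder/block_values.
Qed.

Let p := \prod_(e <- u) W e.

(** The later cylinder [c] makes the induction work: removing [block n] leaves a difference of two
    terms of the same form, for [c] and [block n ++ c]. *)
Lemma probability_avoid_cylinder n c : values_in c -> uniq (unzip1 c) ->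
    (forall t, t \in unzip1 c -> (n * size u <= t)%N) ->
  P (avoid n `&` cylinder c) = ((1 - p) ^+ n * \prod_(p <- c) W p.2)%:E.
Proof.
elim: n c => [|n IH] c cA cu cn.
  by rewrite setTI expr0 mul1r probability_cylinder.
have bu : unzip1 (block n) = iota (n * size u) (size u).
  by rewrite unzip1_zip ?size_iota.
have mac : measurable (avoid n `&` cylinder c).
  exact: measurableI (measurable_avoid n) (measurable_cylinder cA).
rewrite /= setDE setIAC -setDE.
have -> : P ((avoid n `&` cylinder c) `\` cylinder (block n)) =
    (P (avoid n `&` cylinder c) - P (avoid n `&` cylinder c `&` cylinder (block n)))%E.
  apply: measureD => //; first exact/measurable_cylinder/block_values.
  by rewrite ltey_eq fin_num_measure.
have -> : avoid n `&` cylinder c `&` cylinder (block n) =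
          avoid n `&` cylinder (block n ++ c).
  rewrite -setIA; congr (_ `&` _); apply/seteqP; split => w /=.
    by move=> [cw bw] q; rewrite mem_cat => /orP[]; [exact: bw|exact: cw].
  by move=> cw; split => q qc; apply: cw; rewrite mem_cat qc ?orbT.
rewrite !IH//.
- have -> : \prod_(q <- block n ++ c) W q.2 = p * \prod_(q <- c) W q.2.
    rewrite big_cat; congr (_ * _).
    by rewrite -(big_map snd xpredT W) -[map _ _]/(unzip2 _) unzip2_zip ?size_iota.
  by rewrite -EFinB exprSr; congr EFin; ring.
- by rewrite /values_in all_cat; apply/andP; split => //; exact: block_values.
- rewrite /unzip1 map_cat -/(unzip1 _) bu cat_uniq iota_uniq cu andbT/=.
  apply/hasPn => t /cn; rewrite mulSn mem_iota; lia.
- move=> t; rewrite /unzip1 map_cat -/(unzip1 _) bu mem_cat mem_iota.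
  by move=> /orP[|/cn]; rewrite ?mulSn; lia.
- by move=> t /cn; rewrite mulSn; lia.
Qed.

Hypothesis hW : forall e, e \in A -> 0 < W e.

Lemma ae_block : {ae P, forall w, exists k, cylinder (block k) w}.
Proof.
have Pavoid n : P (avoid n) = ((1 - p) ^+ n)%:E.
  have := @probability_avoid_cylinder n [::] isT isT.
  rewrite big_nil mulr1 => <- //; congr (P _).
  by apply/seteqP; split => w //= [].
have p0 : 0 < p by rewrite /p big_seq; apply: prodr_gt0 => e /(allP uA)/hW.
(* [1 - p] is the probability of [avoid 1], hence nonnegative. *)
have p1 : p <= 1.
  have := probability_le1 P (measurable_avoid 1); rewrite Pavoid expr1 lee_fin.
  have : (0 <= P (avoid 1))%E by [].
  rewrite Pavoid expr1 lee_fin; lra.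
have mA : measurable (\bigcap_n avoid n).
  by apply: bigcapT_measurable => n; exact: measurable_avoid.
exists (\bigcap_n avoid n); split => //.
  apply/eqP; rewrite eq_le measure_ge0 andbT.
  have fA : P (\bigcap_n avoid n) \is a fin_num by exact: fin_num_measure.
  rewrite -(fineK fA) lee_fin.
  have c0 : (fun n => (1 - p) ^+ n) @ \oo --> (0 : R).
    by apply: cvg_expr; rewrite ltr_norml; lra.
  apply: (cvgr_to_ge c0); apply: nearW => n.
  rewrite -lee_fin fineK// -Pavoid le_measure ?inE//; first exact: measurable_avoid.
  exact: bigcap_inf.
move=> w /= /forallNP nw n _; elim: n => //= n IH; split => //; exact: nw.
Qed.

End Words.

Lemma cylinder_block d (Omega : measurableType d) (T : finType)
    (X : nat -> Omega -> T) u k w :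
  cylinder X (block u k) w ->
  [seq X s w | s <- iota (k * size u) (size u)] = u.
Proof.
move=> cw; have : [seq X s w | s <- unzip1 (block u k)] = unzip2 (block u k).
  by rewrite /unzip1 /unzip2 -map_comp; apply/eq_in_map => p /cw.
by rewrite unzip1_zip ?unzip2_zip ?size_iota.
Qed.

(** The deviation of [x_i] from the average is the mean of the differences [x_i - x_k]. *)
Lemma average_dist (R : realType) (N : nat) (x : 'cV[R]_N) :
  (forall i j, `|x i 0 - x j 0| <= 1) -> `|x - average x *: const_mx 1| <= 1.
Proof.
move=> xx; rewrite [leLHS]/Num.Def.normr/= mx_normrE; apply: bigmax_le => // -[i j] _ /=.
rewrite ord1 !mxE mulr1 /average.
have N0 : 0 < N%:R :> R by rewrite ltr0n (leq_ltn_trans _ (ltn_ord i)).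
have -> : x i 0 - N%:R^-1 * \sum_k x k 0 = N%:R^-1 * \sum_k (x i 0 - x k 0).
  rewrite big_split /= sumr_const card_ord sumrN mulrDr mulrN; congr (_ - _).
  by rewrite -[x i 0 *+ N]mulr_natr mulrCA mulVf ?mulr1// gt_eqF.
rewrite normrM ger0_norm ?invr_ge0 ?(ltW N0)// ler_pdivrMl// mulr1.
apply: (le_trans (ler_norm_sum _ _ _)).
apply: (@le_trans _ _ (\sum_(k < N) 1)); first exact: ler_sum.
by rewrite sumr_const card_ord.
Qed.

Theorem corollary3p3 (R : realType) (N : nat) (E : {set {set 'I_N}})
    (hE : edges_join_distinct E) (hconn : connected_graph E)
    (W : {set 'I_N} -> R)
    (hWpos : forall e, e \in E -> 0 < W e)
    (hWsum : \sum_(e in E) W e = 1)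
    (d : measure_display) (Omega : measurableType d)
    (P : probability Omega R)
    (edge : nat -> Omega -> {set 'I_N})
    (hlaw : forall t, has_law P E W (edge t))
    (hindep : mutually_independent P edge)
    (x0 : 'cV[R]_N) (x : nat -> Omega -> 'cV[R]_N)
    (hx0 : forall w, x 0%N w = x0)
    (hstep : forall t w,
       compensating_step (@quantizer R) (edge t w) (x t w) (x t.+1 w)) :
  {ae P, forall w, exists Tcon : nat, forall t : nat, (Tcon <= t)%N ->
     (forall i j, `|x t w i 0 - x t w j 0| <= 1) /\
     `|x t w - average (x 0%N w) *: const_mx 1| <= 1}.
Proof.
have edgeE t w : edge t w \in E by have [] := hlaw t.
have xS t w : x t.+1 w = gossip (edge t w) (x t w).
  exact: compensating_stepE (edgeE t w) (hstep t w).
have xD w a n : x (a + n)%N w = gossips [seq edge s w | s <- iota a n] (x a w).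
  elim: n => [|n IH]; first by rewrite addn0.
  by rewrite addnS xS IH -(addn1 n) iotaD map_cat gossips_cat.
have xreach w a n : reach E (x a w) (x (a + n)%N w).
  exists [seq edge s w | s <- iota a n]; last exact: xD.
  by apply/allP => e /mapP[s _ ->]; exact: edgeE.
have xavg t w : average (x t w) = average (x 0%N w).
  rewrite /average; congr (_ * _).
  by elim: t => // t <-; rewrite xS (gossip_sum hE _ (edgeE t w)).
(* This word depends on [x0] alone, so it works from whichever random state a block starts in. *)
have [u uE ur] := recurrent_word hE x0.
apply: filterS (ae_block hlaw hindep uE hWpos) => w [k /cylinder_block uk].
(* The end of the block in which [u] occurs; recurrence persists from then on. *)
exists (k * size u + size u)%N => t le_t.
have rt : recurrent E (x t w).
  rewrite -(subnKC le_t); apply: recurrent_reach (xreach _ _ _).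
  by rewrite xD uk; apply: ur;
    have := xreach w 0%N (k * size u)%N; rewrite add0n hx0.
have spread i j : `|x t w i 0 - x t w j 0| <= 1 by apply: recurrent_spread rt.
by split=> //; rewrite -(xavg t); exact: average_dist.
Qed.
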